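(* Consider Problem P: find $u=u(x,t)$, $x\ge 0$, $t\ge 0$, with $$u_t(x,t)-u_{xx}(x,t)=-\Phi(x)F(u_x(0,t),t)\ (x>0,\,t>0),\qquad u(x,0)=h(x)\ (x>0),\qquad u(0,t)=0\ (t>0).$$ 1. Problem P does not admit any non-trivial solution (i.e. any solution other than the zero function) which is independent of the space variable $x$. 2. Suppose that either (a) $F$ is the zero function and $h(x)=\eta x$ for $x\ge 0$, for some $\eta>0$; or (b) $F$ is the constant function $F(V,t)=\nu$ for all $V\in\mathbb{R}$, $t>0$, for some $\nu\in\mathbb{R}\setminus\{0\}$, and $h$ is a twice differentiable function such that $h(0)$ exists and $h''(x)=\nu\Phi(x)$ for all $x>0$. Then the function $u(x,t)=h(x)$, $x\ge 0$, $t\ge 0$, is a solution to Problem P independent of the temporal variable $t$.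
   Context: In Problem P, $\Phi=\Phi(x)$ and $h=h(x)$ are given real functions defined for $x>0$, $F=F(V,t)$ is a given real function defined for $V\in\mathbb{R}$, $t>0$, and $h$ is always assumed to satisfy the compatibility condition $\lim_{x\to 0^+}h(x)=0$. Accordingly, the value $h(0)$, when it exists, is this limit, i.e. $h(0)=0$. *)

(* Defs.v *)
From mathcomp Require Import all_boot all_order all_algebra.
From mathcomp Require Import all_classical all_reals all_analysis.

Set Implicit Arguments.
Unset Strict Implicit.
Unset Printing Implicit Defensive.

Import Order.TTheory GRing.Theory Num.Theory.
Import numFieldNormedType.Exports.

Local Open Scope ring_scope.
Local Open Scope classical_set_scope.

(* Functions given for x > 0, or on the closed quadrant x >= 0, t >= 0, are
   total functions; their values elsewhere are never used. *)

Definition compatible (R : realType) (h : R -> R) : Prop :=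
  h x @[x --> 0^'+] --> (0 : R).

(* The datum h with its value at 0 being the limit of h at 0+. *)
Definition ext0 (R : realType) (h : R -> R) (x : R) : R :=
  if 0 < x then h x else lim (h y @[y --> 0^'+]).

(* u_x(0,t) exists, as a derivative from the right, and equals V. *)
Definition flux_at0 (R : realType) (u : R -> R -> R) (t V : R) : Prop :=
  (u x t - u 0 t) / x @[x --> 0^'+] --> V.

(* s is the value of the term F(u_x(0,t),t). When F(.,t) is constant this term
   is that constant and does not involve u_x(0,t), which need not exist (e.g.
   u(x,t) = sqrt x with Phi(x) F = - x^(-3/2) / 4); in all other cases
   u_x(0,t) has to exist. *)
Definition source_value (R : realType) (F : R -> R -> R) (u : R -> R -> R)
    (t s : R) : Prop :=
  (exists2 V : R, flux_at0 u t V & s = F V t) \/ (forall V : R, F V t = s).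

Definition is_solution (R : realType) (Phi h : R -> R) (F : R -> R -> R)
    (u : R -> R -> R) : Prop :=
  [/\ forall x t : R, 0 < x -> 0 < t ->
        [/\ derivable (u x) t 1,
            derivable (u ^~ t) x 1 & derivable (u ^~ t)^`() x 1],
      forall t : R, 0 < t -> exists2 s : R, source_value F u t s &
        forall x : R, 0 < x ->
          (u x)^`()%classic t - (u ^~ t)^`(2)%classic x = - Phi x * s,
      forall x : R, 0 < x -> u x 0 = h x &
      forall t : R, 0 < t -> u 0 t = 0].

Definition space_independent (R : realType) (u : R -> R -> R) : Prop :=
  forall x y t : R, 0 <= x -> 0 <= y -> 0 <= t -> u x t = u y t.

Definition time_independent (R : realType) (u : R -> R -> R) : Prop :=
  forall x s t : R, 0 <= x -> 0 <= s -> 0 <= t -> u x s = u x t.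

Definition zero_function (R : realType) (u : R -> R -> R) : Prop :=
  forall x t : R, 0 <= x -> 0 <= t -> u x t = 0.

Definition twice_differentiable (R : realType) (h : R -> R) : Prop :=
  forall x : R, 0 < x -> derivable h x 1 /\ derivable h^`() x 1.

(* Main.v *)
Require Import Defs.
From mathcomp Require Import all_boot all_order all_algebra.
From mathcomp Require Import all_classical all_reals all_analysis.

Set Implicit Arguments.
Unset Strict Implicit.
Unset Printing Implicit Defensive.

Import Order.TTheory GRing.Theory Num.Theory.
Import numFieldNormedType.Exports.

Local Open Scope ring_scope.
Local Open Scope classical_set_scope.

(** If u does not depend on x, the boundary condition u(0,t) = 0 forces it to vanish for t > 0. At t
    = 0 its common value is h(x) for every x > 0, hence the limit of h at 0+, which is 0 by
    compatibility ([space_independent_solution_eq0]). For the second claim, when F is a constant nu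
    and h'' = nu Phi, the function u(x,t) = h(x) has u_t = 0 and -u_xx = -Phi nu, as required.
    [stationary_is_solution] proves this for any real nu, so that (a) becomes the case nu = 0 with h
    linear. *)

(** The half-line of positive reals is open, so derivatives at its points ignore the arbitrary
    values that total functions take elsewhere. *)
Lemma near_eq_pos (R : realType) (f g : R -> R) (x : R) :
  (forall y, 0 < y -> f y = g y) -> 0 < x -> \near x, f x = g x.
Proof. by move=> fg x0; apply: filterS (lt_nbhsr x0) => y; exact: fg. Qed.

Lemma eq_pos_derivable (R : realType) (f g : R -> R) (x : R) :
  (forall y, 0 < y -> f y = g y) -> 0 < x -> derivable f x 1 ->
  derivable g x 1.
Proof. by move=> fg x0; apply: near_eq_derivable; exact: near_eq_pos. Qed.

Lemma eq_pos_derive1 (R : realType) (f g : R -> R) (x : R) :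
  (forall y, 0 < y -> f y = g y) -> 0 < x ->
  f^`()%classic x = g^`()%classic x.
Proof.
by move=> fg x0; rewrite !derive1E; apply: near_eq_derive; exact: near_eq_pos.
Qed.

Lemma ext0_0 (R : realType) (h : R -> R) : compatible h -> ext0 h 0 = 0.
Proof. by move=> h0; rewrite /ext0 ltxx; exact: cvg_lim. Qed.

Lemma ext0_pos (R : realType) (h : R -> R) (x : R) : 0 < x -> ext0 h x = h x.
Proof. by rewrite /ext0 => ->. Qed.

Lemma space_independent_solution_eq0 (R : realType) (Phi h : R -> R)
    (F u : R -> R -> R) :
  compatible h -> is_solution Phi h F u -> space_independent u ->
  zero_function u.
Proof.
move=> h0 [_ _ uh u0] uc x t x0; rewrite le_eqVlt => /predU1P[<-|t0]; last first.
  by rewrite (uc _ 0)// ?u0// ltW.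
(* Now t = 0: near 0+ the function h is constantly [u 1 0], so this value is the limit of h. *)
rewrite (uc _ 1)//; apply/esym.
rewrite -[LHS](cvg_lim (@Rhausdorff R) h0); apply: lim_near_cst => //.
near=> y; have y0 : 0 < y by near: y; exact: nbhs_right_gt.
by rewrite -uh//; apply: uc => //; exact: ltW.
Unshelve. all: by end_near. Qed.

Lemma stationary_is_solution (R : realType) (Phi h : R -> R) (F u : R -> R -> R)
    (nu : R) :
  compatible h -> (forall V t : R, 0 < t -> F V t = nu) ->
  twice_differentiable h ->
  (forall x : R, 0 < x -> h^`(2)%classic x = nu * Phi x) ->
  (forall x t : R, 0 <= x -> 0 <= t -> u x t = ext0 h x) ->
  is_solution Phi h F u.
Proof.
move=> h0 Fnu h2 hPhi uh.
have eu x t : 0 < x -> 0 <= t -> u x t = h x.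
  by move=> x0 t0; rewrite uh ?ext0_pos// ltW.
have eut x : 0 < x -> forall s, 0 < s -> cst (h x) s = u x s.
  by move=> x0 s s0; rewrite eu// ltW.
have eux t : 0 < t -> forall y, 0 < y -> h y = u y t.
  by move=> t0 y y0; rewrite eu// ltW.
(* The first derivatives agree on the whole half-line, so they can be differentiated once more. *)
have edu t : 0 < t -> forall y, 0 < y -> h^`() y = (u ^~ t)^`() y.
  by move=> t0 y y0; apply: eq_pos_derive1 => //; exact: eux.
split.
- move=> x t x0 t0; have [dh ddh] := h2 x x0; split.
  + exact: (eq_pos_derivable (eut x x0)).
  + exact: (eq_pos_derivable (eux t t0)).
  + exact: (eq_pos_derivable (edu t t0)).
(* The second alternative of [source_value] is taken because h may have no right derivative at 0. *)
- move=> t t0; exists nu; first by right=> V; exact: Fnu.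
  move=> x x0; rewrite -(eq_pos_derive1 (eut x x0))// derive1_cst.
  have /esym := hPhi x x0.
  rewrite !derive1nS !derive1n0 (eq_pos_derive1 (edu t t0))// => <-.
  by rewrite sub0r mulNr mulrC.
- by move=> x x0; exact: eu.
- by move=> t t0; rewrite uh ?ext0_0// ltW.
Qed.

Lemma derive1_mulr (R : realType) (a : R) : ( *%R a)^`() = cst a.
Proof.
apply/funext => x; rewrite derive1E.
by rewrite (@deriveZ _ _ _ id a x 1)// derive_id scaler1.
Qed.

Theorem theorem2p1 (R : realType) (Phi h : R -> R) (F : R -> R -> R)
    (hcompat : compatible h) :
  (~ exists u : R -> R -> R,
      [/\ is_solution Phi h F u, space_independent u & ~ zero_function u])
  /\
  ((((forall V t : R, 0 < t -> F V t = 0) /\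
     (exists2 eta : R, 0 < eta & forall x : R, 0 <= x -> ext0 h x = eta * x))
    \/
    (exists2 nu : R, nu != 0 &
      [/\ forall V t : R, 0 < t -> F V t = nu,
          twice_differentiable h,
          cvg (h x @[x --> 0^'+]) &
          forall x : R, 0 < x -> h^`(2)%classic x = nu * Phi x])) ->
   forall u : R -> R -> R,
     (forall x t : R, 0 <= x -> 0 <= t -> u x t = ext0 h x) ->
     is_solution Phi h F u /\ time_independent u).
Proof.
split=> [[u [us uc unz]]|hyp u uh].
  exact/unz/(space_independent_solution_eq0 hcompat us uc).
split; last by move=> x s t x0 s0 t0; rewrite !uh.
case: hyp => [[F0 [eta _ hE]]|[nu _ [Fnu h2 _ hPhi]]]; last first.
  exact: stationary_is_solution Fnu h2 hPhi uh.
have eh y : 0 < y -> eta * y = h y by move=> y0; rewrite -hE ?ext0_pos// ltW.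
have edh y : 0 < y -> cst eta y = h^`() y.
  by move=> y0; rewrite -(eq_pos_derive1 eh)// derive1_mulr.
(* Supplying [F0] fixes nu = 0; it remains to see that h is twice differentiable with h'' = 0, which
   holds since h' is constantly eta. *)
apply: (stationary_is_solution hcompat F0 _ _ uh) => [x x0|x x0].
  split; last exact: (eq_pos_derivable edh).
  by apply: (eq_pos_derivable eh) => //; exact: (@derivableZ _ _ _ id).
by rewrite mul0r derive1nS -(eq_pos_derive1 edh)// derive1_cst.
Qed.
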